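(* Let $(a_\nu)_{\nu\in\mathbb{Z}_{\ge 0}^3}$ be a family of quaternions. Suppose that there are constants $r_0, M, N_0\in\mathbb{R}$ such that for all integers $n>N_0$ and all multi-indices $\nu=(n_1,n_2,n_3)\in\mathbb{Z}_{\ge 0}^3$ with $\|\nu\|=n_1+n_2+n_3=n$ we have $\|a_\nu\|\,r_0^n\le M$. Then the series $$f(x)=\sum_{n=0}^\infty\ \sum_{\substack{\nu=(n_1,n_2,n_3)\\ n_1+n_2+n_3=n}} P_\nu(x)\, a_\nu$$ converges compactly on $B'(0,r_0)$.
   Context: $\mathbb{H}=\{x_0+ix_1+jx_2+kx_3 : x_0,x_1,x_2,x_3\in\mathbb{R}\}$ denotes the quaternions ($i^2=j^2=k^2=ijk=-1$), with Euclidean norm $\|\cdot\|$. For $x=x_0+ix_1+jx_2+kx_3$, the Fueter basis is $\zeta_1(x)=x_1-ix_0$, $\zeta_2(x)=x_2-jx_0$, $\zeta_3(x)=x_3-kx_0$. For a multi-index $\nu=(n_1,n_2,n_3)\in\mathbb{Z}_{\ge0}^3$ put $\|\nu\|=n_1+n_2+n_3=n$, let $A_\nu$ be the set of all words $(i_1,\dots,i_n)$ of length $n$ with exactly $n_1$ letters $1$, $n_2$ letters $2$ and $n_3$ letters $3$, and define $$P_\nu(x)=\frac{1}{n!}\sum_{(i_1,\dots,i_n)\in A_\nu}\zeta_{i_1}(x)\cdots\zeta_{i_n}(x)$$ (the product over the empty word is $1$). The auxiliary norm is $\|x_0+ix_1+jx_2+kx_3\|'=\max\{\sqrt{x_0^2+x_1^2},\sqrt{x_0^2+x_2^2},\sqrt{x_0^2+x_3^2}\}$,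 and $B'(0,r)=\{x\in\mathbb{H}:\|x\|'<r\}$. A series $\sum_{n}\sum_{\|\nu\|=n}P_\nu a_\nu$ converges compactly on an open set if its partial sums over $n\le N$ converge, as $N\to\infty$, uniformly on every compact subset of that set. *)

(* Defs.v *)
From HB Require Import structures.
From mathcomp Require Import all_boot all_order all_algebra ring lra.
From mathcomp Require Import all_classical all_reals all_analysis.

Set Implicit Arguments.
Unset Strict Implicit.
Unset Printing Implicit Defensive.

Import Order.TTheory GRing.Theory Num.Theory.
Import numFieldNormedType.Exports.

Local Open Scope classical_set_scope.
Local Open Scope ring_scope.

(* [Quat x0 x1 x2 x3] stands for x0 + i x1 + j x2 + k x3. *)
Record quat (R : Type) := Quat { q0 : R; q1 : R; q2 : R; q3 : R }.

Section QuatRing.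
Variable R : realType.
Implicit Types x y z : quat R.

Definition quat_tuple x := (q0 x, q1 x, q2 x, q3 x).
Definition tuple_quat (t : R * R * R * R) :=
  Quat t.1.1.1 t.1.1.2 t.1.2 t.2.
Lemma quat_tupleK : cancel quat_tuple tuple_quat.
Proof. by case. Qed.

HB.instance Definition _ := Choice.copy (quat R) (can_type quat_tupleK).

Definition addq x y :=
  Quat (q0 x + q0 y) (q1 x + q1 y) (q2 x + q2 y) (q3 x + q3 y).
Definition oppq x := Quat (- q0 x) (- q1 x) (- q2 x) (- q3 x).
Definition zeroq : quat R := Quat 0 0 0 0.
Definition oneq : quat R := Quat 1 0 0 0.
Definition mulq x y := Quat
  (q0 x * q0 y - q1 x * q1 y - q2 x * q2 y - q3 x * q3 y)
  (q0 x * q1 y + q1 x * q0 y + q2 x * q3 y - q3 x * q2 y)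
  (q0 x * q2 y - q1 x * q3 y + q2 x * q0 y + q3 x * q1 y)
  (q0 x * q3 y + q1 x * q2 y - q2 x * q1 y + q3 x * q0 y).
Definition scaleq (c : R) x := Quat (c * q0 x) (c * q1 x) (c * q2 x) (c * q3 x).

Let addqA : associative addq.
Proof. by move=> x y z; rewrite /addq /=; congr Quat; ring. Qed.
Let addqC : commutative addq.
Proof. by move=> x y; rewrite /addq /=; congr Quat; ring. Qed.
Let add0q : left_id zeroq addq.
Proof. by case=> *; rewrite /addq /=; congr Quat; ring. Qed.
Let addNq : left_inverse zeroq oppq addq.
Proof. by move=> x; rewrite /addq /zeroq /=; congr Quat; ring. Qed.

HB.instance Definition _ :=
  GRing.isZmodule.Build (quat R) addqA addqC add0q addNq.

Let mulqA : associative mulq.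
Proof. by move=> x y z; rewrite /mulq /=; congr Quat; ring. Qed.
Let mul1q : left_id oneq mulq.
Proof. by case=> *; rewrite /mulq /=; congr Quat; ring. Qed.
Let mulq1 : right_id oneq mulq.
Proof. by case=> *; rewrite /mulq /=; congr Quat; ring. Qed.
Let mulqDl : left_distributive mulq (@GRing.add (quat R)).
Proof. by move=> x y z; congr Quat; rewrite /=; ring. Qed.
Let mulqDr : right_distributive mulq (@GRing.add (quat R)).
Proof. by move=> x y z; congr Quat; rewrite /=; ring. Qed.
Let oneq_neq0 : oneq != 0.
Proof. by apply/eqP => -[] /eqP; rewrite oner_eq0. Qed.

HB.instance Definition _ := GRing.Zmodule_isNzRing.Build (quat R)
  mulqA mul1q mulq1 mulqDl mulqDr oneq_neq0.

Let scaleqA a b x : scaleq a (scaleq b x) = scaleq (a * b) x.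
Proof. by rewrite /scaleq /=; congr Quat; ring. Qed.
Let scale1q : left_id 1 scaleq.
Proof. by case=> *; rewrite /scaleq /=; congr Quat; ring. Qed.
Let scaleqDr : right_distributive scaleq (@GRing.add (quat R)).
Proof. by move=> a x y; congr Quat; rewrite /=; ring. Qed.
Let scaleqDl x : {morph scaleq^~ x : a b / a + b}.
Proof. by move=> a b; congr Quat; rewrite /=; ring. Qed.

HB.instance Definition _ := GRing.Zmodule_isLmodule.Build R (quat R)
  scaleqA scale1q scaleqDr scaleqDl.

Let scaleqAl (a : R) x y : a *: (x * y) = (a *: x) * y.
Proof. by congr Quat; rewrite /=; ring. Qed.
Let scaleqAr (a : R) x y : a *: (x * y) = x * (a *: y).
Proof. by congr Quat; rewrite /=; ring. Qed.

HB.instance Definition _ := GRing.Lmodule_isLalgebra.Build R (quat R) scaleqAl.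
HB.instance Definition _ := GRing.Lalgebra_isAlgebra.Build R (quat R) scaleqAr.

Definition normq x := Num.sqrt (q0 x ^+ 2 + q1 x ^+ 2 + q2 x ^+ 2 + q3 x ^+ 2).

Let ler_normqD x y : normq (x + y) <= normq x + normq y.
Proof.
rewrite /normq /=.
set A := q0 x ^+ 2 + _ + _ + _; set B := q0 y ^+ 2 + _ + _ + _.
have A0 : 0 <= A by rewrite !addr_ge0 ?sqr_ge0.
have B0 : 0 <= B by rewrite !addr_ge0 ?sqr_ge0.
pose c := q0 x * q0 y + q1 x * q1 y + q2 x * q2 y + q3 x * q3 y.
have cAB : c ^+ 2 <= A * B.
  rewrite -subr_ge0 [leRHS](_ : _ =
    (q0 x * q1 y - q1 x * q0 y) ^+ 2 + (q0 x * q2 y - q2 x * q0 y) ^+ 2 +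
    (q0 x * q3 y - q3 x * q0 y) ^+ 2 + (q1 x * q2 y - q2 x * q1 y) ^+ 2 +
    (q1 x * q3 y - q3 x * q1 y) ^+ 2 + (q2 x * q3 y - q3 x * q2 y) ^+ 2).
    by rewrite !addr_ge0 ?sqr_ge0.
  by rewrite /A /B /c; ring.
have cs : c <= Num.sqrt A * Num.sqrt B.
  rewrite -sqrtrM// (le_trans (ler_norm c))// -sqrtr_sqr ler_sqrt//.
  by rewrite mulr_ge0.
rewrite -[leRHS]ger0_norm ?addr_ge0 ?sqrtr_ge0// -sqrtr_sqr ler_sqrt ?sqr_ge0//.
rewrite [leRHS]sqrrD !sqr_sqrtr// [leLHS](_ : _ = A + c *+ 2 + B); last first.
  by rewrite /A /B /c; ring.
by rewrite lerD2r lerD2l lerMn2r cs.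
Qed.

Let normqZ (l : R) x : normq (l *: x) = `|l| * normq x.
Proof.
rewrite /normq /= -(sqrtr_sqr l) -sqrtrM ?sqr_ge0//.
by congr Num.sqrt; ring.
Qed.

Let normq0_eq0 x : normq x = 0 -> x = 0.
Proof.
case: x => a b c d; rewrite /normq /= => /eqP; rewrite sqrtr_eq0 => h.
have [a0 b0 c0 d0] : [/\ a = 0, b = 0, c = 0 & d = 0].
  have a0 := sqr_ge0 a; have b0 := sqr_ge0 b.
  have c0 := sqr_ge0 c; have d0 := sqr_ge0 d.
  by split; apply/eqP; rewrite -sqrf_eq0 eq_le; apply/andP; split=> //; lra.
by rewrite a0 b0 c0 d0.
Qed.

(* This also equips [quat R] with the topology and uniformity of the Euclidean
   norm. *)
HB.instance Definition _ :=
  Lmodule_isNormed.Build R (quat R) ler_normqD normqZ normq0_eq0.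

Definition qi : quat R := Quat 0 1 0 0.
Definition qj : quat R := Quat 0 0 1 0.
Definition qk : quat R := Quat 0 0 0 1.

Lemma quat_relations :
  [/\ qi ^+ 2 = -1, qj ^+ 2 = -1, qk ^+ 2 = -1 & qi * qj * qk = -1].
Proof. by split; congr Quat; rewrite /=; ring. Qed.

Lemma quatE x :
  x = (q0 x)%:A + qi * (q1 x)%:A + qj * (q2 x)%:A + qk * (q3 x)%:A.
Proof. by case: x => *; congr Quat; rewrite /=; ring. Qed.

Lemma quat_normE x :
  `|x| = Num.sqrt (q0 x ^+ 2 + q1 x ^+ 2 + q2 x ^+ 2 + q3 x ^+ 2).
Proof. by []. Qed.

End QuatRing.

(* The indices 1, 2, 3 are represented by the ordinals 0, 1, 2 of ['I_3]. *)
Notation multiindex := {ffun 'I_3 -> nat}.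

Definition mi_norm (nu : multiindex) : nat := (\sum_(i < 3) nu i)%N.

Definition words (nu : multiindex) : {set (mi_norm nu).-tuple 'I_3} :=
  [set w : (mi_norm nu).-tuple 'I_3 | [forall i, count_mem i w == nu i]]%SET.

Section Fueter.
Variable R : realType.
Implicit Types x : quat R.

Definition zeta (i : 'I_3) x : quat R :=
  nth 0 [:: (q1 x)%:A - qi R * (q0 x)%:A;
            (q2 x)%:A - qj R * (q0 x)%:A;
            (q3 x)%:A - qk R * (q0 x)%:A] i.

Definition fueterP (nu : multiindex) x : quat R :=
  ((mi_norm nu)`!%:R : R)^-1 *: \sum_(w in words nu) \prod_(i <- w) zeta i x.

Definition norm' x : R :=
  Num.max (Num.max (Num.sqrt (q0 x ^+ 2 + q1 x ^+ 2))
                   (Num.sqrt (q0 x ^+ 2 + q2 x ^+ 2)))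
          (Num.sqrt (q0 x ^+ 2 + q3 x ^+ 2)).

Definition ball' (r : R) : set (quat R) := [set x | norm' x < r].

Definition fueter_partial_sum (a : multiindex -> quat R) (N : nat) x : quat R :=
  \sum_(n < N.+1) \sum_(nu \in [set nu : multiindex | mi_norm nu = n])
    fueterP nu x * a nu.

End Fueter.

(* [compactly_in U] is the family of compact subsets of [U]; values outside [U]
   are irrelevant. *)
Definition converges_compactly_on (T : topologicalType) (V : uniformType)
    (U : set T) (s : nat -> T -> V) : Prop :=
  exists f : T -> V, {family compactly_in U, s @ \oo --> f}.

(* Main.v *)
(* The word set of a multi-index of norm n has at most 3^n elements and there
   are at most (n+1)^3 <= 8^n such multi-indices.  As ||zeta_i(x)|| <= ||x||',
   the terms of degree n > N0 add up to at most M 24^n / n! on B'(0,r0), so the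
   Weierstrass M-test yields uniform convergence on the whole of B'(0,r0). *)
Require Import Defs.
From HB Require Import structures.
From mathcomp Require Import all_boot all_order all_algebra ring lra.
From mathcomp Require Import all_classical all_reals all_analysis.
Import Order.TTheory GRing.Theory Num.Theory.
Import numFieldNormedType.Exports.
Local Open Scope classical_set_scope.
Local Open Scope ring_scope.

(** After squaring, this is Euler's four-square identity, which [ring] verifies. *)
Lemma quat_normM (R : realType) (x y : quat R) : `|x * y| = `|x| * `|y|.
Proof.
rewrite !quat_normE /= -sqrtrM; last by rewrite !addr_ge0 ?sqr_ge0.
by congr Num.sqrt; ring.
Qed.

Lemma quat_norm1 (R : realType) : `|1 : quat R| = 1.
Proof. by rewrite quat_normE /= !expr0n expr1n !addr0 sqrtr1. Qed.

Lemma quat_norm_prod (R : realType) (I : Type) (s : seq I) (F : I -> quat R) :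
  `|\prod_(i <- s) F i| = \prod_(i <- s) `|F i|.
Proof.
elim: s => [|i s IHs]; first by rewrite !big_nil quat_norm1.
by rewrite !big_cons quat_normM IHs.
Qed.

Lemma quat_norm_le (R : realType) (x : quat R) :
  `|x| <= `|q0 x| + `|q1 x| + `|q2 x| + `|q3 x|.
Proof.
rewrite {1}(quatE x); do ![apply: (le_trans (ler_normD _ _)); apply: lerD];
  rewrite ?quat_normM normrZ quat_norm1 mulr1 ?quat_normE //=;
  by rewrite !expr0n !expr1n ?addr0 ?add0r sqrtr1 mul1r.
Qed.

Lemma quat_coord_le (R : realType) (x : quat R) :
  [/\ `|q0 x| <= `|x|, `|q1 x| <= `|x|, `|q2 x| <= `|x| & `|q3 x| <= `|x|].
Proof.
have h0 := sqr_ge0 (q0 x); have h1 := sqr_ge0 (q1 x).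
have h2 := sqr_ge0 (q2 x); have h3 := sqr_ge0 (q3 x).
by rewrite quat_normE; split; rewrite -sqrtr_sqr ler_wsqrtr//; lra.
Qed.

(** Each coordinate is 1-Lipschitz, so it sends a Cauchy filter to a Cauchy filter of reals. The
    four real limits form the quaternion limit, each coordinate contributing at most e / 4 to the
    error. *)
Lemma quat_cauchy_cvg (R : realType) (F : set_system (quat R)) :
  ProperFilter F -> cauchy F -> cvg F.
Proof.
move=> FF /cauchy_ballP Fc.
have coord (q : quat R -> R) :
    (forall x y, `|q x - q y| <= `|x - y|) -> cvg (q @ F).
  move=> qle; apply: cauchy_cvg; apply/cauchy_ballP => e e0.
  rewrite near_map2; apply: filterS (Fc _ e0) => -[x y].
  rewrite /= -!ball_normE /=.
  exact: le_lt_trans (qle _ _).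
have cle x y := quat_coord_le _ (x - y : quat R).
have /coord c0 : forall x y : quat R, `|q0 x - q0 y| <= `|x - y|.
  by move=> x y; case: (cle x y).
have /coord c1 : forall x y : quat R, `|q1 x - q1 y| <= `|x - y|.
  by move=> x y; case: (cle x y).
have /coord c2 : forall x y : quat R, `|q2 x - q2 y| <= `|x - y|.
  by move=> x y; case: (cle x y).
have /coord c3 : forall x y : quat R, `|q3 x - q3 y| <= `|x - y|.
  by move=> x y; case: (cle x y).
apply/cvg_ex; exists (Quat (lim (@q0 R @ F)) (lim (@q1 R @ F))
                           (lim (@q2 R @ F)) (lim (@q3 R @ F))).
apply/cvgrPdist_le => e e0; have e4 : 0 < e / 4 by rewrite divr_gt0.
near=> x.
apply: le_trans (quat_norm_le _ _) _ => /=.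
rewrite [leRHS](_ : _ = e / 4 + e / 4 + e / 4 + e / 4); last by lra.
rewrite !lerD//; near: x.
- exact: (cvgrPdist_le _ _).1 c0 _ e4.
- exact: (cvgrPdist_le _ _).1 c1 _ e4.
- exact: (cvgrPdist_le _ _).1 c2 _ e4.
- exact: (cvgrPdist_le _ _).1 c3 _ e4.
Unshelve. all: by end_near.
Qed.

HB.instance Definition _ (R : realType) :=
  Uniform_isComplete.Build (quat R) (@quat_cauchy_cvg R).

(** The test bears on the increments of [s], and only from rank [m0] on, because the coefficients
    are controlled only in degrees beyond [N0]. *)
Lemma weierstrass_M_test (R : realType) (T : choiceType)
    (V : completeNormedModType R) (A : set T) (s : nat -> T -> V)
    (u : nat -> R) (m0 : nat) :
  cvgn (series u) ->
  (forall n x, (m0 <= n)%N -> A x -> `|s n.+1 x - s n x| <= u n) ->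
  exists f, {uniform A, s @ \oo --> f}.
Proof.
move=> /cvg_ex[/= l /cvgrPdist_lt ul] su.
(* Uniform Cauchy estimate: the increments telescope to a difference of two partial sums of [u],
   each within e / 2 of [l]. *)
have small e : 0 < e -> exists2 K, (m0 <= K)%N & forall m n x, A x ->
    (K <= m)%N -> (m <= n)%N -> `|s n x - s m x| <= e.
  move=> e0; have [K _ uK] := ul _ (divr_gt0 e0 (ltr0Sn R 1)).
  exists (maxn m0 K); first exact: leq_maxl.
  move=> m n x Ax; rewrite geq_max => /andP[m0m Km] mn.
  have {}su : `|s n x - s m x| <= series u n - series u m.
    rewrite sub_series_geq// -(telescope_sumr (s^~ x))//.
    apply: (le_trans (ler_norm_sum _ _ _)); apply: ler_sum_nat => k /andP[mk _].
    exact: su (leq_trans m0m mk) Ax.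
  have := uK _ Km; have := uK _ (leq_trans Km mn); rewrite /= !ltr_norml.
  by move=> /andP[] ? ? /andP[] ? ?; apply: le_trans su _; lra.
have cvgs x : A x -> cvgn (s^~ x).
  move=> Ax; apply: cauchy_cvg; apply: cauchy_exP => e e0.
  have [K _ sK] := small _ (divr_gt0 e0 (ltr0Sn R 1)).
  exists (s K x); exists K => // n /= Kn; rewrite -ball_normE /= distrC.
  by apply: le_lt_trans (sK _ _ _ Ax (leqnn _) Kn) _; lra.
(* The candidate is the pointwise limit; its values outside [A], where [limn] may be a default, do
   not affect uniform convergence on [A]. *)
exists (fun x => limn (s^~ x)) => P; rewrite uniform_nbhs => -[E [entE EP]].
apply: filterS EP _; move: entE; rewrite -entourage_ballE => -[e /= e0 eE].
have [K _ sK] := small _ (divr_gt0 e0 (ltr0Sn R 1)).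
exists K => // m /= Km x Ax; apply: eE; rewrite /= -ball_normE /=.
apply: (@le_lt_trans _ _ (e / 2)); last by lra.
(* With [m] fixed, letting n tend to infinity in the Cauchy estimate keeps the bound e / 2. *)
have : (fun n => `|s n x - s m x|) @ \oo --> `|limn (s^~ x) - s m x|.
  by apply: cvg_norm; apply: cvgB; [exact: cvgs | exact: cvg_cst].
move=> c; rewrite -(cvg_lim _ c)//; apply: (limr_le (cvgP _ c)).
by exists m => // n /= mn; exact: sK.
Qed.

(** Only the real coordinate and one imaginary coordinate of [zeta i x] can be nonzero, so its norm
    is one of the three square roots whose maximum is [norm' x]. *)
Lemma zeta_norm_le (R : realType) (i : 'I_3) (x : quat R) :
  `|zeta i x| <= norm' x.
Proof.
rewrite /norm' quat_normE; case: i => -[|[|[|//]]] ? /=;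
  rewrite !le_max; [apply/orP; left; apply/orP; left|
    apply/orP; left; apply/orP; right|apply/orP; right];
  by rewrite ler_wsqrtr// le_eqVlt; apply/orP; left; apply/eqP; ring.
Qed.

Lemma fueterP_norm_le (R : realType) (nu : multiindex) (x : quat R) :
  `|fueterP nu x| <=
  3 ^+ mi_norm nu / (mi_norm nu)`!%:R * norm' x ^+ mi_norm nu.
Proof.
set n := mi_norm nu.
rewrite normrZ normfV normr_nat mulrAC mulrC ler_wpM2r ?invr_ge0//.
apply: (le_trans (ler_norm_sum _ _ _)).
apply: (@le_trans _ _ (\sum_(w in words nu) norm' x ^+ n)).
  apply: ler_sum => w _; rewrite quat_norm_prod.
  rewrite -[leRHS](_ : \prod_(i <- w) norm' x = _).
    by apply: ler_prod => i _; rewrite normr_ge0 zeta_norm_le.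
  by rewrite big_const_seq count_predT size_tuple iter_mulr_1.
rewrite sumr_const -[leLHS]mulr_natl ler_wpM2r ?exprn_ge0//.
  by apply: le_trans (zeta_norm_le _ ord0 x).
by rewrite -natrX ler_nat (leq_trans (max_card _))// card_tuple card_ord.
Qed.

Lemma mi_norm_fsum_le (R : realType) (V : normedModType R) (n : nat)
    (F : multiindex -> V) (B : R) :
  0 <= B -> (forall nu, mi_norm nu = n -> `|F nu| <= B) ->
  `|\sum_(nu \in [set nu : multiindex | mi_norm nu = n]) F nu| <= 8 ^+ n * B.
Proof.
move=> B0 FB.
(* The entries of a multi-index of norm [n] are at most [n], so it is the image under [h] of one of
   (n+1)^3 bounded functions. This turns the sum over a set into a sum over the duplicate-free list
   [r]. *)
pose h (g : {ffun 'I_3 -> 'I_n.+1}) : multiindex := [ffun i => g i : nat].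
have h_inj : injective h.
  move=> g g' /ffunP e; apply/ffunP => i; apply/val_inj.
  by have := e i; rewrite !ffunE.
pose r := [seq nu <- [seq h g | g : {ffun 'I_3 -> 'I_n.+1}] | mi_norm nu == n].
have r_uniq : uniq r by rewrite filter_uniq// map_inj_uniq// enum_uniq.
have -> : [set nu : multiindex | mi_norm nu = n] = [set` r].
  apply/seteqP; split=> nu /=; rewrite mem_filter; last by case/andP=> /eqP.
  move=> nun; rewrite nun eqxx /=; apply/mapP.
  have nui i : (nu i < n.+1)%N.
    by rewrite ltnS -nun /mi_norm (bigD1 i)//= leq_addr.
  exists [ffun i => Ordinal (nui i)]; first by rewrite mem_enum.
  by apply/ffunP => i; rewrite !ffunE.
rewrite -fsbig_seq//; apply: (le_trans (ler_norm_sum _ _ _)).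
apply: (@le_trans _ _ (\sum_(nu <- r) B)).
  rewrite big_seq [leRHS]big_seq; apply: ler_sum => nu.
  by rewrite mem_filter => /andP[/eqP + _]; exact: FB.
rewrite big_const_seq count_predT iter_addr_0 -[leLHS]mulr_natl ler_wpM2r//.
rewrite -natrX ler_nat size_filter (leq_trans (count_size _ _))//.
(* Since 8^n = (2^n)^3, the bound (n+1)^3 <= 8^n reduces to n + 1 <= 2^n. *)
rewrite size_map -cardE card_ffun !card_ord -[8%N]/(2 ^ 3)%N -expnM mulnC expnM.
by rewrite leq_exp2r// ltn_expl.
Qed.

Theorem theorem3p0p2 (R : realType) (a : multiindex -> quat R) (r0 M N0 : R)
    (ha : forall (n : nat) (nu : multiindex),
        N0 < n%:R -> mi_norm nu = n -> `|a nu| * r0 ^+ n <= M) :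
  converges_compactly_on (ball' r0) (fueter_partial_sum a).
Proof.
(* The increment from [n] to n + 1 has degree n + 1 and is at most |M| 24^(n+1) / (n+1)!. Weakening
   (n+1)! to n! makes the bound a multiple of the n-th exponential coefficient at 24. *)
pose u n : R := (24 * `|M|) * exp_coeff 24 n.
have u_cvg : cvgn (series u).
  apply: (@is_cvg_seriesZ _ (exp_coeff 24) (24 * `|M|)).
  exact: is_cvg_series_exp_coeff.
have step n x : (Num.bound `|N0| <= n)%N -> ball' r0 x ->
    `|fueter_partial_sum a n.+1 x - fueter_partial_sum a n x| <= u n.
  move=> Nn; rewrite /ball' /= => xr0.
  have x0 : 0 <= norm' x := le_trans (normr_ge0 _) (zeta_norm_le _ ord0 x).
  have N0n : N0 < n.+1%:R.
    rewrite (le_lt_trans (ler_norm N0))// (lt_le_trans (archi_boundP _))//.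
    by rewrite ler_nat ltnW.
  rewrite /fueter_partial_sum [X in `|X - _|]big_ord_recr /= addrAC subrr add0r.
  pose B : R := 3 ^+ n.+1 / n.+1`!%:R * `|M|.
  have B0 : 0 <= B by rewrite !mulr_ge0// ?invr_ge0// exprn_ge0.
  apply: (le_trans (mi_norm_fsum_le _ _ _ _ B B0 _)) => [nu nun|].
    rewrite quat_normM.
    apply: (le_trans (ler_wpM2r _ (fueterP_norm_le _ _ _))) => //.
    rewrite nun -[leLHS]mulrA ler_wpM2l ?divr_ge0 ?exprn_ge0//.
    (* The existence of [x] with 0 <= [norm' x] < [r0] makes [r0] positive, so powers of [norm' x]
       are dominated by those of [r0] and [ha] applies. *)
    apply: le_trans (ler_norm M); apply: le_trans (ha _ _ N0n nun).
    rewrite mulrC ler_wpM2l// lerXn2r ?nnegrE ?(ltW xr0)//.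
    by rewrite (le_trans x0)// ltW.
  rewrite /u /exp_coeff /B /=.
  have -> : 8 ^+ n.+1 * (3 ^+ n.+1 / n.+1`!%:R * `|M|) =
      24 * `|M| * (24 ^+ n / n.+1`!%:R) :> R.
    have -> : 24 ^+ n = 8 ^+ n * 3 ^+ n :> R by rewrite -exprMn -natrM.
    by rewrite !exprS; ring.
  rewrite !ler_wpM2l ?mulr_ge0 ?exprn_ge0//.
  by rewrite lef_pV2 ?posrE ?ltr0n ?fact_gt0// ler_nat leq_fact.
have [f sf] := weierstrass_M_test _ _ _ _ _ _ _ u_cvg step.
(* Uniform convergence on the whole ball restricts to any subset [K], in particular to a compact
   one. *)
exists f; apply/fam_cvgP => K [KU _] P; rewrite uniform_nbhs => -[E [entE EP]].
apply: sf; rewrite uniform_nbhs; exists E; split=> // h hE.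
by apply: EP => y /KU; exact: hE.
Qed.
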